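(* Let $D>1$, $C_0,C_1,C_2\ge1$ and $p>D$. There exists a constant $c>0$, depending only on $p,D,C_0,C_1,C_2$, such that, for every connected locally finite weighted graph $(V,\omega,\mu)$ satisfying conditions (G1)–(G3) listed in the context with the constants $D,C_0,C_1,C_2$, every nonempty finite subset $\Omega\subset V$ and every $w:\Omega\to[0,\infty)$ with $w\not\equiv0$, $$\lambda_{1,p}(\Omega,w)\ge\frac{c}{r_\Omega^{\,p-D}\,\|w\|_{\ell^1(\Omega,\mu)}}.$$
   Context: A weighted graph is a triple $(V,\omega,\mu)$ where $V$ is a countably infinite set, $\mu:V\to(0,\infty)$, and $\omega:V\times V\to[0,\infty)$ satisfies $\omega_{xy}=\omega_{yx}$ and $\omega_{xx}=0$. Write $x\sim y$ if $\omega_{xy}>0$, and $\deg(x)=\#\{y\in V:y\sim x\}$. The graph is locally finite if $\deg(x)<\infty$ for all $x$, and connected if any two vertices are joined by a finite path $x=x_0\sim x_1\sim\cdots\sim x_m=y$ (of length $m$). The graph distance $d(x,y)$ is the minimal length of a path from $x$ to $y$; $B(x,R)=\{y\in V:d(x,y)\le R\}$ for real $R\ge0$; $\mu(A)=\sum_{x\in A}\mu(x)$ for finite $A\subset V$. Conditions: (G1) $C_0^{-1}\le\mu(x)\le C_0$ for all $x\in V$; $C_0^{-1}\le\omega_{xy}\le C_0$ whenever $x\sim y$; $\deg(x)\le C_0$ for all $x\in V$. (G2) $C_1^{-1}R^D\le\mu(B(x,R))\le C_1R^D$ for all $x\in V$ and all real $R\ge1$. (G3) For every $x_0\in V$, every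 $R\ge1$ and every $A\subset B(x_0,R)$, $$\min\{\mu(A),\mu(B(x_0,R)\setminus A)\}\le C_2R\sum_{\substack{x\in A,\ y\in B(x_0,R)\setminus A\\ y\sim x}}\omega_{xy}.$$ $X_V(\Omega)=\{u:V\to\mathbb{R}:u=0\text{ in }V\setminus\Omega\}$; $E_p(u)=\frac12\sum_{x,y\in V}\omega_{xy}|u(y)-u(x)|^p$; $\|w\|_{\ell^1(\Omega,\mu)}=\sum_{x\in\Omega}\mu(x)|w(x)|$; the inner radius is $r_\Omega=\sup_{x\in\Omega}\inf_{y\in V\setminus\Omega}d(x,y)$. The first weighted Dirichlet eigenvalue is $$\lambda_{1,p}(\Omega,w)=\inf\left\{\frac{E_p(u)}{\sum_{x\in\Omega}\mu(x)w(x)|u(x)|^p}:\ u\in X_V(\Omega),\ \sum_{x\in\Omega}\mu(x)w(x)|u(x)|^p>0\right\}.$$ *)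

(* Defs.v *)
From HB Require Import structures.
From mathcomp Require Import all_boot all_order all_algebra finmap.
From mathcomp Require Import all_classical all_reals all_analysis.

Set Implicit Arguments.
Unset Strict Implicit.
Unset Printing Implicit Defensive.

Import Order.TTheory GRing.Theory Num.Theory.
Local Open Scope classical_set_scope.
Local Open Scope ring_scope.

Record weighted_graph (R : realType) (V : choiceType) := WeightedGraph {
  omega : V -> V -> R;
  mu : V -> R;
  vertices_countably_infinite : ([set: V] #= [set: nat])%card;
  mu_gt0 : forall x, 0 < mu x;
  omega_ge0 : forall x y, 0 <= omega x y;
  omega_sym : forall x y, omega x y = omega y x;
  omega_diag : forall x, omega x x = 0 }.

Section WeightedGraphs.
Context {R : realType} {V : choiceType}.
Implicit Types (G : weighted_graph R V) (x y : V) (A : set V) (u : V -> R).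
Implicit Types (Omega : {fset V}) (r p : R) (n : nat).

Definition adj G : rel V := fun x y => 0 < omega G x y.

Definition neighbours G x : set V := [set y | adj G x y].

Definition locally_finite G : Prop := forall x, finite_set (neighbours G x).

(* [fset_set] is the empty set on infinite sets, so [deg] is only meaningful
   for locally finite graphs. *)
Definition deg G x : nat := #|` fset_set (neighbours G x)|.

Definition walk G x y n : Prop :=
  exists s : seq V, [/\ size s = n, path (adj G) x s & last x s = y].

Definition connected_graph G : Prop := forall x y, exists n, walk G x y n.

(* The default value 0 is only reached if [x] and [y] are not connected. *)
Definition gdist G x y : nat :=
  xget 0%N [set n | walk G x y n /\ forall m, walk G x y m -> (n <= m)%N].

Definition gball G x r : set V := [set y | (gdist G x y)%:R <= r].

(* A finitely supported sum: only meaningful for finite [A]; the balls of a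
   connected locally finite graph are finite. *)
Definition vol G A : R := \sum_(x \in A) mu G x.

Definition condG1 G (C0 : R) : Prop :=
  [/\ forall x, C0^-1 <= mu G x <= C0,
      forall x y, adj G x y -> C0^-1 <= omega G x y <= C0
    & forall x, (deg G x)%:R <= C0].

Definition condG2 G (D C1 : R) : Prop :=
  forall x r, 1 <= r ->
    C1^-1 * r `^ D <= vol G (gball G x r) <= C1 * r `^ D.

Definition condG3 G (C2 : R) : Prop :=
  forall x0 r A, 1 <= r -> A `<=` gball G x0 r ->
    Num.min (vol G A) (vol G (gball G x0 r `\` A)) <=
    C2 * r * \sum_(x \in A)
               \sum_(y \in (gball G x0 r `\` A) `&` neighbours G x) omega G x y.

Definition zero_outside Omega : set (V -> R) :=
  [set u | forall x, x \notin Omega -> u x = 0].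

Definition energy G p u : \bar R :=
  ((2^-1)%:E * \esum_(z in [set: V * V])
                 (omega G z.1 z.2 * `|u z.2 - u z.1| `^ p)%:E)%E.

Definition weighted_pnorm G p Omega (w : Omega -> R) u : R :=
  \sum_(x : Omega) mu G (val x) * w x * `|u (val x)| `^ p.

Definition lambda1 G p Omega (w : Omega -> R) : \bar R :=
  ereal_inf [set (energy G p u * ((weighted_pnorm G p w u)^-1)%:E)%E | u in
               zero_outside Omega `&` [set u | 0 < weighted_pnorm G p w u]].

Definition l1norm G Omega (w : Omega -> R) : R :=
  \sum_(x : Omega) mu G (val x) * `|w x|.

(* For nonempty [Omega] both sets are nonempty, the complement of [Omega] being
   infinite, and bounded on the relevant side: [sup] and [inf] are genuine. *)
Definition inner_radius G Omega : R :=
  sup [set inf [set ((gdist G x y)%:R : R) | y in [set y | y \notin Omega]]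
      | x in [set x | x \in Omega]].

End WeightedGraphs.

(* Main.v *)
Require Import Defs.
From HB Require Import structures.
From mathcomp Require Import all_boot all_order all_algebra finmap.
From mathcomp Require Import all_classical all_reals all_analysis.
From mathcomp Require Import ring lra.

Set Implicit Arguments.
Unset Strict Implicit.
Unset Printing Implicit Defensive.

Import Order.TTheory GRing.Theory Num.Theory.
Local Open Scope classical_set_scope.
Local Open Scope ring_scope.

(** The estimate is a Morrey inequality in disguise.  If every function [u]
    satisfies [|u x - u y|^p <= K * E_p(u) * d(x, y)^(p - D)], then for [u]
    vanishing off [Omega] one takes [x] in [Omega] and [y] a nearest point of
    the complement: [d(x, y)] is at most the inner radius, [u y = 0], and so
    [|u x|^p <= K * E_p(u) * r^(p - D)].  Weighting by [mu * w] and summing over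
    [Omega] bounds the denominator of the Rayleigh quotient by
    [K * r^(p - D) * |w|_1 * E_p(u)].

    The Morrey inequality comes from three facts about balls.

    - Isoperimetry gives an L^1 Poincare inequality ([poincare1]).  Both
      sides are double sums of a kernel against [|u x - u y|], and such sums
      are positive combinations of their values at indicator functions of
      superlevel sets (discrete coarea formula, [cut_kernel]); on an indicator
      the inequality is the isoperimetric one, because
      [mu A * mu (B - A) <= mu B * min (mu A) (mu (B - A))].

    - Replacing the L^1 norm of the gradient by its L^p norm costs
      [r^(D - D / p)] on a ball of radius [r] ([mean_oscillation]); the mean
      oscillation on that ball is therefore of order [r^a] with
      [a = 1 - D / p], which is positive because [p > D].

    - The means of [u] on concentric balls of radii [2^k] and [2^(k + 1)] then
      differ by a multiple of [2^(k * a)]: a geometric series, dominated by its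
      last term ([point_mean]).  Comparing the means on two balls of radius
      about [d(x, y)] around [x] and [y] finishes the proof ([morrey]). *)

(** * The discrete coarea formula *)

Lemma seq_argmin (R : realDomainType) (T : eqType) (s : seq T) (P : pred T)
    (f : T -> R) : has P s ->
  exists x, [/\ x \in s, P x & {in s, forall y, P y -> f x <= f y}].
Proof.
elim: s => // z s IHs /=; have [Ps|/hasPn nPs] := boolP (has P s); last first.
  rewrite orbF => Pz; exists z; split; rewrite ?mem_head// => y.
  by rewrite inE => /predU1P[->//|/nPs/negP].
move=> _; have [x [xs Px xmin]] := IHs Ps.
have [/andP[Pz zx]|nz] := boolP (P z && (f z <= f x)).
  exists z; split; rewrite ?mem_head// => y.
  rewrite inE => /predU1P[->//|ys Py]; exact: le_trans (xmin _ ys Py).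
exists x; split; rewrite ?inE ?xs ?orbT// => y /predU1P[->|]; last exact: xmin.
by move=> Pz; move: nz; rewrite Pz /= -ltNge => /ltW.
Qed.

(** Peel off the lowest positive level [t] of [u]: with [u'] the function
    [u - t] and [a] the set where [u] is positive, the positive parts satisfy
    [u^+ = t * 1_a + u'^+] on [s], and the increments of the two terms add up
    without cancellation.  The set where [u'] is positive is strictly smaller. *)
Lemma cut_kernel_pos (R : realDomainType) (T : eqType) (s : seq T)
    (g : T -> T -> R) :
  (forall a : pred T,
     0 <= \sum_(x <- s | a x) \sum_(y <- s | ~~ a y) g x y) ->
  forall u : T -> R, 0 <= \sum_(x <- s) \sum_(y <- s)
    g x y * Num.max (Num.max (u x) 0 - Num.max (u y) 0) 0.
Proof.
move=> g_cut u; have [n] := ubnP (count (fun x => 0 < u x) s).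
elim: n u => // n IHn u; rewrite ltnS => cnt.
have [pos|/hasPn npos] := boolP (has (fun x => 0 < u x) s); last first.
  rewrite big_seq big1// => x xs; rewrite big_seq big1// => y ys.
  have := npos _ xs; have := npos _ ys; rewrite -!leNgt => uy ux.
  by rewrite !(max_r ux) (max_r uy) subr0 max_r// mulr0.
have [x0 [x0s ux0 x0min]] := seq_argmin u pos.
pose u' x := u x - u x0.
have cnt' : (count (fun x => (0 < u' x)%R) s < n)%N.
  apply: leq_trans cnt; set P := fun x => _.
  have -> : (count P s).+1 = (count P s + 1)%N by rewrite addn1.
  have x01 : (1 <= count (pred1 x0) s)%N by rewrite -has_count has_pred1.
  apply: leq_trans (leq_add (leqnn _) x01) _; rewrite -count_predUI.
  rewrite [X in (_ + X)%N](eq_count (a2 := pred0)) ?count_pred0 ?addn0.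
    apply: sub_count => x /orP[|/eqP->//].
    by rewrite /P /u' subr_gt0; exact: lt_trans.
  move=> x /=; apply/negbTE/negP => /andP[+ /eqP xE].
  by rewrite /P xE /u' subrr ltxx.
have -> : \sum_(x <- s) \sum_(y <- s)
    g x y * Num.max (Num.max (u x) 0 - Num.max (u y) 0) 0 =
  u x0 * (\sum_(x <- s | 0 < u x) \sum_(y <- s | ~~ (0 < u y)) g x y) +
  \sum_(x <- s) \sum_(y <- s)
    g x y * Num.max (Num.max (u' x) 0 - Num.max (u' y) 0) 0.
  rewrite [X in u x0 * X]big_mkcond mulr_sumr -big_split/=.
  rewrite [LHS]big_seq [RHS]big_seq; apply: eq_bigr => x xs.
  have -> : (if 0 < u x then \sum_(y <- s | ~~ (0 < u y)) g x y else 0) =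
      \sum_(y <- s) if (0 < u x) && ~~ (0 < u y) then g x y else 0.
    by case: ifP => ux /=; [rewrite big_mkcond|rewrite big1].
  rewrite mulr_sumr -big_split/= [LHS]big_seq [RHS]big_seq.
  apply: eq_bigr => y ys; move: (x0min _ xs) (x0min _ ys); rewrite /u' /=.
  have [ux|ux] := ltP 0 (u x); have [uy|uy] := ltP 0 (u y) => /= x0x x0y.
  - move: (x0x isT) (x0y isT) => {}x0x {}x0y.
    rewrite (@max_l _ _ (u x - u x0)) ?subr_ge0//.
    rewrite (@max_l _ _ (u y - u x0)) ?subr_ge0//.
    by rewrite mulr0 add0r; congr (_ * Num.max _ _); ring.
  - move: (x0x isT) => {}x0x.
    rewrite (@max_l _ _ (u x - u x0)) ?subr_ge0//.
    rewrite (@max_r _ _ (u y - u x0)); last lra.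
    by rewrite !subr0 !max_l ?subr_ge0 ?(ltW ux)//; ring.
  - move: (x0y isT) => {}x0y.
    rewrite (@max_r _ _ (u x - u x0)); last lra.
    rewrite (@max_l _ _ (u y - u x0)); last lra.
    by rewrite !max_r ?mulr0 ?addr0//; lra.
  - rewrite (@max_r _ _ (u x - u x0)); last lra.
    rewrite (@max_r _ _ (u y - u x0)); last lra.
    by rewrite subrr mulr0 add0r.
by apply: addr_ge0; [apply: mulr_ge0; [exact: ltW|exact: g_cut]|exact: IHn].
Qed.

(** The kernel [g] may change sign: this is what lets an inequality between two
    positive kernels be transferred from indicators to all functions, by taking
    for [g] their difference. *)
Lemma cut_kernel (R : realDomainType) (T : eqType) (s : seq T)
    (g : T -> T -> R) :
  (forall a : pred T,
     0 <= \sum_(x <- s | a x) \sum_(y <- s | ~~ a y) g x y) ->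
  forall u : T -> R, 0 <= \sum_(x <- s) \sum_(y <- s) g x y * `|u x - u y|.
Proof.
move=> g_cut u.
have half (v : T -> R) : 0 <= \sum_(x <- s) \sum_(y <- s)
    g x y * Num.max (v x - v y) 0.
  (* Only increments matter, so [u] may be shifted to be nonnegative on [s]. *)
  pose M := \sum_(x <- s) `|v x|.
  have vM x : x \in s -> 0 <= v x + M.
    move=> xs; have : `|v x| <= M.
      by rewrite /M (big_rem x)//= lerDl sumr_ge0.
    by have := ler_norm (- v x); rewrite normrN; lra.
  have := cut_kernel_pos g_cut (fun x => v x + M).
  rewrite big_seq [in X in _ -> X]big_seq; congr (_ <= _).
  apply: eq_bigr => x xs; rewrite big_seq [RHS]big_seq; apply: eq_bigr => y ys.
  by rewrite !(max_l (vM _ _))//; congr (_ * Num.max _ _); ring.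
have := addr_ge0 (half u) (half (fun x => - u x)); rewrite -big_split/=.
congr (_ <= _); apply: eq_bigr => x _; rewrite -big_split/=.
apply: eq_bigr => y _; rewrite -mulrDr; congr (_ * _).
have [uxy|uxy] := lerP (u y) (u x).
  by rewrite max_l ?max_r ?ger0_norm; lra.
by rewrite max_r ?max_l ?ltr0_norm; lra.
Qed.

(** * The graph metric *)

Lemma walk_cat (R : realType) (V : choiceType) (G : weighted_graph R V) x y z
    m n : walk G x y m -> walk G y z n -> walk G x z (m + n).
Proof.
move=> [s [<- sp sl]] [t [<- tp tl]]; exists (s ++ t).
by rewrite size_cat cat_path last_cat sl sp tp tl.
Qed.

Lemma walk_rev (R : realType) (V : choiceType) (G : weighted_graph R V) x y n :
  walk G x y n -> walk G y x n.
Proof.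
move=> [s [<- sp sl]]; exists (rev (belast x s)); split.
- by rewrite size_rev size_belast.
- rewrite -sl rev_path; move: sp; apply: sub_path => a b.
  by rewrite /adj omega_sym.
- by case: s sp sl => //= z s _ _; rewrite rev_cons last_rcons.
Qed.

Section GraphDistance.
Context {R : realType} {V : choiceType} (G : weighted_graph R V).
Hypothesis conn : connected_graph G.

Lemma gdistP x y :
  walk G x y (gdist G x y) /\ forall m, walk G x y m -> (gdist G x y <= m)%N.
Proof.
apply: (@xgetPex _ 0%N [set n | walk G x y n /\
  forall m, walk G x y m -> (n <= m)%N]).
have ex : exists n, `[< walk G x y n >].
  by have [n w] := conn x y; exists n; apply/asboolP.
exists (ex_minn ex); case: ex_minnP => n /asboolP w nmin; split=> // m wm.
by apply: nmin; apply/asboolP.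
Qed.

Lemma gdist_refl x : gdist G x x = 0%N.
Proof.
by apply/eqP; rewrite -leqn0; have [_] := gdistP x x; apply; exists [::].
Qed.

Lemma gdist_eq0 x y : gdist G x y = 0%N -> x = y.
Proof.
by have [[s [+ _ sl]] _] := gdistP x y => + d0; rewrite d0 -sl => /size0nil ->.
Qed.

Lemma gdist_sym x y : gdist G x y = gdist G y x.
Proof.
wlog suff : x y / (gdist G x y <= gdist G y x)%N.
  by move=> le; apply/eqP; rewrite eqn_leq !le.
by apply: (gdistP x y).2; apply: walk_rev; exact: (gdistP y x).1.
Qed.

Lemma gdist_triangle x y z : (gdist G x z <= gdist G x y + gdist G y z)%N.
Proof.
by apply: (gdistP x z).2; apply: walk_cat (gdistP x y).1 (gdistP y z).1.
Qed.

End GraphDistance.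

(** * Balls and the Poincare inequality *)

Definition fball (R : realType) (V : choiceType) (G : weighted_graph R V)
  (x : V) (r : R) : {fset V} := fset_set (gball G x r).

Definition mean (R : realType) (V : choiceType) (G : weighted_graph R V)
    (B : {fset V}) (u : V -> R) : R :=
  (\sum_(x <- B) mu G x * u x) / \sum_(x <- B) mu G x.

Lemma fsum_setI (R : realType) (V : choiceType) (B : set V) (a : pred V)
    (f : V -> R) : finite_set B ->
  \sum_(x \in B `&` [set x | a x]) f x = \sum_(x <- fset_set B | a x) f x.
Proof.
move=> finB; rewrite fsbig_mkcondr fsbig_finite// [RHS]big_mkcond.
by apply: eq_bigr => x _; rewrite mem_setE.
Qed.

Section Balls.
Context {R : realType} {V : choiceType} (G : weighted_graph R V).
Context {D C1 : R}.
Hypothesis C1_gt0 : 0 < C1.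
Hypothesis volume_growth : condG2 G D C1.

(** A sum of positive terms over an infinite index set is zero by convention,
    whereas the lower volume bound is positive. *)
Lemma finite_gball x r : 1 <= r -> finite_set (gball G x r).
Proof.
move=> r1; apply: contrapT => infB.
have /andP[+ _] := volume_growth x r1; rewrite /vol fsbig_dflt.
  by rewrite leNgt mulr_gt0// ?invr_gt0// powR_gt0// (lt_le_trans _ r1).
move=> fin; apply: infB; apply: sub_finite_set fin => y By; split => //=.
by apply/eqP; rewrite gt_eqF// mu_gt0.
Qed.

Lemma mem_fball x r y : 1 <= r -> (y \in fball G x r) = ((gdist G x y)%:R <= r).
Proof. by move=> r1; rewrite in_fset_set ?mem_setE//; exact: finite_gball. Qed.

Lemma vol_fball x r : 1 <= r ->
  vol G (gball G x r) = \sum_(y <- fball G x r) mu G y.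
Proof. by move=> r1; rewrite /vol fsbig_finite//; exact: finite_gball. Qed.

Lemma fball_volume x r : 1 <= r ->
  C1^-1 * r `^ D <= \sum_(y <- fball G x r) mu G y <= C1 * r `^ D.
Proof. by move=> r1; rewrite -vol_fball//; exact: volume_growth. Qed.

Lemma fball_volume_gt0 x r : 1 <= r -> 0 < \sum_(y <- fball G x r) mu G y.
Proof.
move=> r1; have /andP[+ _] := fball_volume x r1; apply: lt_le_trans.
by rewrite mulr_gt0// ?invr_gt0// powR_gt0// (lt_le_trans _ r1).
Qed.

Lemma fball_cut C2 x r (a : pred V) : condG3 G C2 -> 1 <= r ->
  Num.min (\sum_(y <- fball G x r | a y) mu G y)
          (\sum_(y <- fball G x r | ~~ a y) mu G y) <=
  C2 * r * \sum_(y <- fball G x r | a y)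
             \sum_(z <- fball G x r | ~~ a z) omega G y z.
Proof.
move=> isop r1; have finB := finite_gball x r1.
pose A := gball G x r `&` [set y | a y].
have DA : gball G x r `\` A = gball G x r `&` [set y | ~~ a y].
  apply/seteqP; split=> y /= [By nA]; split => //.
    by apply/negP => ay; apply: nA.
  by move=> [_]; apply/negP.
have := isop x r A r1 (@subIsetl _ _ _); rewrite DA /vol !fsum_setI//.
congr (_ <= _ * _); apply: eq_bigr => y ay.
rewrite (_ : _ `&` _ = gball G x r `&` [set z | ~~ a z && adj G y z]);
    last first.
  apply/seteqP; split=> z /=.
    by move=> [[Bz az] yz]; split=> //; apply/andP.
  by move=> [Bz /andP[az yz]].
rewrite fsum_setI// -[LHS]big_filter_cond/= -[RHS]big_filter big_filter_cond.
rewrite [RHS]big_filter big_mkcondr; apply: eq_bigr => z _.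
case: ifPn => //; rewrite /adj -leNgt => yz.
by apply/eqP; rewrite eq_le yz omega_ge0.
Qed.

(** Apply [cut_kernel] to [C2 * r * mu(B) * omega y z - mu y * mu z].  Working
    with the double sum of [mu y * mu z * |u y - u z|] rather than with a median
    lets the mean appear at once, by the triangle inequality. *)
Lemma poincare1 C2 x r (u : V -> R) : condG3 G C2 -> 1 <= r ->
  \sum_(y <- fball G x r) mu G y * `|u y - mean G (fball G x r) u| <=
  C2 * r * \sum_(y <- fball G x r) \sum_(z <- fball G x r)
             omega G y z * `|u y - u z|.
Proof.
move=> isop r1; set B := fball G x r.
have v0 : 0 < \sum_(y <- B) mu G y by exact: fball_volume_gt0.
move vE : (\sum_(y <- B) mu G y) v0 => v v0.
have := @cut_kernel _ _ B
  (fun y z => C2 * r * v * omega G y z - mu G y * mu G z) _ u.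
have sumM (a b : pred V) : \sum_(y <- B | a y) \sum_(z <- B | b z)
    mu G y * mu G z =
    (\sum_(y <- B | a y) mu G y) * (\sum_(z <- B | b z) mu G z).
  by rewrite mulr_suml; apply: eq_bigr => y _; rewrite mulr_sumr.
have cut_ge0 (a : pred V) : 0 <= \sum_(y <- B | a y) \sum_(z <- B | ~~ a z)
    (C2 * r * v * omega G y z - mu G y * mu G z).
  under eq_bigr do rewrite sumrB -mulr_sumr.
  rewrite sumrB sumM -mulr_sumr.
  have := fball_cut x a isop r1; rewrite -/B.
  have : v = \sum_(y <- B | a y) mu G y + \sum_(z <- B | ~~ a z) mu G z.
    by rewrite -vE (bigID a).
  have : 0 <= \sum_(y <- B | a y) mu G y.
    by apply: sumr_ge0 => y _; exact/ltW/mu_gt0.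
  have : 0 <= \sum_(y <- B | ~~ a y) mu G y.
    by apply: sumr_ge0 => y _; exact/ltW/mu_gt0.
  move: (\sum_(_ <- _ | a _) mu _ _) (\sum_(_ <- _ | ~~ a _) mu _ _) => p q.
  move: (\sum_(_ <- _ | _) _) => c q0 p0 vpq.
  have [pq|qp] := leP p q => cut; nra.
move=> /(_ cut_ge0).
have -> : \sum_(y <- B) \sum_(z <- B)
    (C2 * r * v * omega G y z - mu G y * mu G z) * `|u y - u z| =
    v * (C2 * r * \sum_(y <- B) \sum_(z <- B) omega G y z * `|u y - u z|) -
    \sum_(y <- B) mu G y * \sum_(z <- B) mu G z * `|u y - u z|.
  rewrite !mulr_sumr -sumrB; apply: eq_bigr => y _.
  rewrite !mulr_sumr -sumrB; apply: eq_bigr => z _.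
  ring.
rewrite subr_ge0 -[in X in _ -> X](ler_pM2l v0); apply: le_trans.
rewrite mulr_sumr; apply: ler_sum => y _.
rewrite mulrCA ler_pM2l ?mu_gt0//.
rewrite -{1}(gtr0_norm v0) -normrM mulrBr mulrC /mean vE.
rewrite mulrCA mulfV ?gt_eqF// mulr1 -vE mulr_sumr -sumrB.
apply: le_trans (ler_norm_sum _ _ _) _; apply: ler_sum => z _.
by rewrite mulrC -mulrBr normrM (gtr0_norm (mu_gt0 G z)).
Qed.

End Balls.

(** * Pointwise tools for the Morrey inequality *)

(** A substitute for Young's inequality: optimising the threshold [T] after
    summation recovers Hoelder's inequality up to a factor. *)
Lemma truncation_powR (R : realType) (p T d : R) : 1 <= p -> 0 < T -> 0 <= d ->
  d <= T + T `^ (1 - p) * d `^ p.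
Proof.
move=> p1 T0 d0; have [dT|Td] := leP d T.
  by rewrite ler_wpDr// mulr_ge0 ?powR_ge0.
have d_gt0 := lt_trans T0 Td.
have -> : 1 - p = - (p - 1) by ring.
rewrite powRN; apply: ler_wpDl (ltW T0) _.
rewrite ler_pdivlMl ?powR_gt0// mulrC.
rewrite -(mulr_powRB1 d0 (lt_le_trans ltr01 p1)) ler_pM2l//.
by rewrite ge0_ler_powR ?nnegrE ?subr_ge0// ltW.
Qed.

(** Average [|m - m'| <= |u x - m| + |u x - m'|] over [A], then enlarge the
    domain of the second sum. *)
Lemma mean_comparison (R : realType) (V : choiceType) (G : weighted_graph R V)
    (A B : {fset V}) (u : V -> R) (m m' : R) : {subset A <= B} ->
  (\sum_(x <- A) mu G x) * `|m - m'| <=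
  \sum_(x <- A) mu G x * `|u x - m| + \sum_(x <- B) mu G x * `|u x - m'|.
Proof.
move=> AB; apply: (@le_trans _ _ (\sum_(x <- A) mu G x * `|u x - m| +
    \sum_(x <- A) mu G x * `|u x - m'|)).
  rewrite mulr_suml -big_split/=; apply: ler_sum => x _.
  rewrite -mulrDr ler_pM2l ?mu_gt0// (distrC (u x) m).
  by apply: le_trans (ler_normD _ _); rewrite le_eqVlt; apply/orP; left;
    apply/eqP; congr (`| _ |); ring.
rewrite lerD2l [leLHS]big_seq (eq_bigr (fun x =>
  if x \in A then mu G x * `|u x - m'| else 0)) => [|x ->//].
rewrite -big_seq; have AsubB : (A `<=` B)%fset by apply/fsubsetP.
rewrite (big_fset_incl _ AsubB) => [|x _ /negbTE -> //].
apply: ler_sum => x _; case: ifP => // _.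
by rewrite mulr_ge0// ltW// mu_gt0.
Qed.

Lemma degree_weight (R : realType) (V : choiceType) (G : weighted_graph R V)
    (C0 : R) (B : {fset V}) x : locally_finite G -> condG1 G C0 -> 0 <= C0 ->
  \sum_(y <- B) omega G x y <= C0 * C0.
Proof.
move=> lf [_ w_le deg_le] C0_ge0.
have -> : \sum_(y <- B) omega G x y = \sum_(y <- B | adj G x y) omega G x y.
  rewrite [RHS]big_mkcond; apply: eq_bigr => y _; rewrite /adj.
  have := omega_ge0 G x y; rewrite le_eqVlt => /predU1P[<-|->//].
  by rewrite ltxx.
apply: le_trans (_ : \sum_(y <- B | adj G x y) C0 <= _).
  by apply: ler_sum => y /w_le /andP[].
rewrite big_const_seq iter_addr_0 -mulr_natl ler_wpM2r//.
apply: le_trans (deg_le x); rewrite ler_nat /deg -size_filter.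
apply: uniq_leq_size; first exact/filter_uniq/fset_uniq.
by move=> y; rewrite mem_filter => /andP[xy _]; rewrite in_fset_set// inE.
Qed.

Lemma powRD_gt0 (R : realType) (x r s : R) : 0 < x ->
  x `^ (r + s) = x `^ r * x `^ s.
Proof. by move=> x0; rewrite powRD// (gt_eqF x0) implybT. Qed.

(** * The Morrey inequality *)

Section Morrey.
Context {R : realType} {D C0 C1 C2 p : R}.
Hypotheses (D_gt1 : 1 < D) (C0_ge1 : 1 <= C0) (C1_ge1 : 1 <= C1).
Hypotheses (C2_ge1 : 1 <= C2) (Dp : D < p).

(* All constants are fixed before the graph, so that they depend on the
   parameters only. *)
Let a := 1 - D / p.
Let K_osc := C2 * (C0 ^+ 3 * C1 + 1).
Let K_mean := C1 * (K_osc * (1 + 2 `^ (D + a))).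
Let K_pt := C0 * K_osc + K_mean / (2 `^ a - 1).
Let K_two := K_pt + K_mean + K_pt * 2 `^ a.

Let C0_gt0 : 0 < C0. Proof. exact: lt_le_trans C0_ge1. Qed.
Let C1_gt0 : 0 < C1. Proof. exact: lt_le_trans C1_ge1. Qed.
Let C2_gt0 : 0 < C2. Proof. exact: lt_le_trans C2_ge1. Qed.
Let p_gt1 : 1 < p. Proof. exact: lt_trans Dp. Qed.
Let p_gt0 : 0 < p. Proof. exact: lt_trans p_gt1. Qed.
Let D_gt0 : 0 < D. Proof. exact: lt_trans D_gt1. Qed.
Let a_gt0 : 0 < a.
Proof. by rewrite /a subr_gt0 ltr_pdivrMr// mul1r. Qed.
Let pow2a_gt1 : 1 < 2 `^ a.
Proof.
have := @gt0_ltr_powR _ a a_gt0 1 2; rewrite powR1 !nnegrE; apply => //.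
by rewrite ltr1n.
Qed.
Let K_osc_gt0 : 0 < K_osc.
Proof. by apply/mulr_gt0/addr_gt0 => //; rewrite mulr_gt0// exprn_gt0. Qed.
Let K_mean_gt0 : 0 < K_mean.
Proof.
apply: mulr_gt0 C1_gt0 (mulr_gt0 K_osc_gt0 (addr_gt0 ltr01 _)).
by rewrite powR_gt0.
Qed.
Let K_pt_gt0 : 0 < K_pt.
Proof.
apply: addr_gt0 (mulr_gt0 C0_gt0 K_osc_gt0) (mulr_gt0 K_mean_gt0 _).
by rewrite invr_gt0 subr_gt0.
Qed.
Let K_two_gt0 : 0 < K_two.
Proof.
apply: addr_gt0 (addr_gt0 K_pt_gt0 K_mean_gt0) (mulr_gt0 K_pt_gt0 _).
by rewrite powR_gt0.
Qed.

Section Graph.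
Context {V : choiceType} (G : weighted_graph R V).
Hypotheses (conn : connected_graph G) (lf : locally_finite G).
Hypotheses (bounded : condG1 G C0) (volume_growth : condG2 G D C1).
Hypothesis isoperimetry : condG3 G C2.
(* The double sums count every edge twice, so [e ^ p] bounds [2 * E_p(u)]. *)
Context (u : V -> R) (e : R).
Hypothesis e_gt0 : 0 < e.
Hypothesis energy_le : forall B : {fset V},
  \sum_(x <- B) \sum_(y <- B) omega G x y * `|u x - u y| `^ p <= e `^ p.

Local Notation ball := (fball G).

Lemma fball_weight x r : 1 <= r ->
  \sum_(y <- ball x r) \sum_(z <- ball x r) omega G y z <=
  C0 ^+ 3 * C1 * r `^ D.
Proof.
move=> r1; have [mu_ge _ _] := bounded.
have /andP[_ volB] := fball_volume C1_gt0 volume_growth x r1.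
rewrite -mulrA; apply: (le_trans _ (ler_wpM2l (exprn_ge0 3 (ltW C0_gt0)) volB)).
rewrite mulr_sumr; apply: ler_sum => y _.
apply: le_trans (degree_weight _ y lf bounded (ltW C0_gt0)) _.
have -> : C0 ^+ 3 * mu G y = C0 * C0 * (C0 * mu G y) by ring.
apply: ler_peMr; first exact: mulr_ge0 (ltW C0_gt0) (ltW C0_gt0).
by have /andP[+ _] := mu_ge y; rewrite -div1r ler_pdivrMr// mulrC.
Qed.

(** The total weight of the ball is of order [r^D] and its energy at most [e^p];
    the threshold [T = e * r^(- D / p)] makes the contributions of both terms
    of [truncation_powR] of the same order [e * r^(D - D / p)]. *)
Lemma mean_oscillation x r : 1 <= r ->
  \sum_(y <- ball x r) mu G y * `|u y - mean G (ball x r) u| <=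
  K_osc * e * r `^ (D + a).
Proof.
move=> r1.
apply: le_trans (poincare1 C1_gt0 volume_growth x u isoperimetry r1) _.
have r0 : 0 < r := lt_le_trans ltr01 r1.
set B := ball x r; pose T := e * r `^ (- (D / p)).
have T0 : 0 < T by rewrite mulr_gt0// powR_gt0.
have weightB : \sum_(y <- B) \sum_(z <- B) omega G y z * `|u y - u z| <=
    T * (C0 ^+ 3 * C1 * r `^ D) + T `^ (1 - p) * e `^ p.
  apply: le_trans (lerD (ler_wpM2l (ltW T0) (fball_weight x r1))
    (ler_wpM2l (powR_ge0 T (1 - p)) (energy_le B))).
  rewrite !mulr_sumr -big_split/=; apply: ler_sum => y _.
  rewrite !mulr_sumr -big_split/=; apply: ler_sum => z _.
  rewrite mulrC (mulrCA (T `^ _)) (mulrC T) -mulrDr mulrC.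
  rewrite ler_wpM2l ?omega_ge0//.
  exact: truncation_powR (ltW p_gt1) T0 (normr_ge0 _).
have TD : T * r `^ D = e * r `^ (D - D / p).
  by rewrite /T -mulrA -powRD_gt0// addrC.
have Tp : T `^ (1 - p) * e `^ p = e * r `^ (D - D / p).
  rewrite /T powRM ?powR_ge0 ?(ltW e_gt0)// mulrAC -powRD_gt0//.
  rewrite subrK powRr1 ?(ltW e_gt0)// -powRrM; congr (_ * _ `^ _).
  by field; rewrite gt_eqF.
apply: le_trans (ler_wpM2l _ weightB) _; first by rewrite mulr_ge0// ltW.
have -> : r `^ (D + a) = r * r `^ (D - D / p).
  rewrite -{2}(powRr1 (ltW r0)) -powRD_gt0//.
  by congr (_ `^ _); rewrite /a; ring.
rewrite Tp (mulrCA T) TD /K_osc le_eqVlt; apply/orP; left; apply/eqP; ring.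
Qed.

Lemma mean_fball_comparison x y r s : 1 <= r -> r <= s -> s <= 2 * r ->
  {subset ball x r <= ball y s} ->
  `|mean G (ball x r) u - mean G (ball y s) u| <= K_mean * e * r `^ a.
Proof.
move=> r1 rs s2r xy; have s1 := le_trans r1 rs.
have r0 : 0 < r := lt_le_trans ltr01 r1; have s0 := lt_le_trans r0 rs.
have := mean_comparison G u (mean G (ball x r) u) (mean G (ball y s) u) xy.
have /andP[+ _] := fball_volume C1_gt0 volume_growth x r1.
move=> /(ler_wpM2r (normr_ge0 (mean G (ball x r) u - mean G (ball y s) u))).
move=> /le_trans/[apply].
move=> /le_trans/(_ (lerD (mean_oscillation x r1) (mean_oscillation y s1))).
have s_le : s `^ (D + a) <= 2 `^ (D + a) * r `^ (D + a).
  rewrite -powRM ?(ltW r0)// ge0_ler_powR// ?nnegrE ?(ltW s0) ?mulr_ge0//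
    ?(ltW r0)//.
  by rewrite addr_ge0// ltW.
have : K_osc * e * s `^ (D + a) <= K_osc * e * (2 `^ (D + a) * r `^ (D + a)).
  by rewrite ler_wpM2l// mulr_ge0// ltW.
rewrite -(lerD2l (K_osc * e * r `^ (D + a))) => /[swap] /le_trans/[apply].
rewrite (powRD_gt0 _ _ r0).
have rD : 0 < C1^-1 * r `^ D by rewrite mulr_gt0 ?invr_gt0 ?powR_gt0.
rewrite -ler_pdivlMl// => /le_trans; apply.
rewrite le_eqVlt; apply/orP; left; apply/eqP; rewrite /K_mean.
by field; rewrite !gt_eqF ?powR_gt0.
Qed.

(** The constant [K_pt] absorbs the geometric series: it satisfies
    [K_pt + K_mean <= K_pt * 2^a], which is the induction step, and
    [C0 * K_osc <= K_pt], which starts the induction since [mu x >= 1 / C0]. *)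
Lemma point_mean x n :
  `|u x - mean G (ball x (2 ^+ n)) u| <= K_pt * e * (2 ^+ n) `^ a.
Proof.
have dbl k : 1 <= 2 ^+ k :> R by rewrite exprn_ege1// ler1n.
elim: n => [|n IHn].
  have [mu_ge _ _] := bounded; rewrite expr0 powR1 mulr1.
  have := mean_oscillation x (lexx 1); rewrite powR1 mulr1.
  have xB : x \in ball x 1.
    by rewrite (mem_fball C1_gt0 volume_growth)// gdist_refl// ler01.
  rewrite (big_fsetD1 x)//= => osc.
  have {osc} osc : mu G x * `|u x - mean G (ball x 1) u| <= K_osc * e.
    apply: le_trans osc; rewrite lerDl sumr_ge0// => y _.
    by rewrite mulr_ge0// ltW// mu_gt0.
  have {mu_ge} /andP[mu_ge _] := mu_ge x.
  have := le_trans (ler_wpM2r (normr_ge0 _) mu_ge) osc.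
  rewrite ler_pdivrMl// => /le_trans; apply.
  rewrite mulrA ler_wpM2r ?(ltW e_gt0)// /K_pt lerDl.
  by rewrite mulr_ge0 ?invr_ge0 ?subr_ge0// ltW.
have sub : {subset ball x (2 ^+ n) <= ball x (2 ^+ n.+1)}.
  move=> y; rewrite !(mem_fball C1_gt0 volume_growth)// => /le_trans; apply.
  by rewrite exprS ler_peMl ?ler1n// ltW// exprn_gt0.
have := mean_fball_comparison (dbl n) _ _ sub; rewrite exprS lexx => /(_ _ isT).
rewrite ler_peMl ?ler1n ?exprn_ge0// => /(_ isT) /(lerD IHn).
move=> /(le_trans (ler_distD _ _ _)) /le_trans; apply.
rewrite powRM ?exprn_ge0// -mulrDl mulrA ler_wpM2r ?powR_ge0//.
rewrite (mulrAC K_pt) -mulrDl ler_wpM2r ?(ltW e_gt0)//.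
have -> : K_pt * 2 `^ a = K_pt + (C0 * K_osc * (2 `^ a - 1) + K_mean).
  by rewrite /K_pt; field; rewrite gt_eqF ?subr_gt0.
rewrite lerD2l lerDr; apply: mulr_ge0; last by rewrite subr_ge0 ltW.
exact: mulr_ge0 (ltW C0_gt0) (ltW K_osc_gt0).
Qed.

(** The ball of radius [2^n] around [x] lies in the ball of radius [2^(n + 1)]
    around [y], so their means are comparable. *)
Lemma two_points_dyadic x y n : (gdist G x y)%:R <= 2 ^+ n :> R ->
  `|u x - u y| <= K_two * e * (2 ^+ n) `^ a.
Proof.
have dbl k : 1 <= 2 ^+ k :> R by rewrite exprn_ege1// ler1n.
move=> xy; have sub : {subset ball x (2 ^+ n) <= ball y (2 ^+ n.+1)}.
  move=> z; rewrite !(mem_fball C1_gt0 volume_growth)// => xz.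
  rewrite exprS mulr_natl mulr2n; apply: le_trans (lerD xy xz).
  by rewrite -natrD ler_nat (gdist_sym conn x y) gdist_triangle.
have := mean_fball_comparison (dbl n) _ _ sub; rewrite exprS lexx => /(_ _ isT).
rewrite ler_peMl ?ler1n ?exprn_ge0// => /(_ isT) means.
have := point_mean y n.+1; rewrite distrC exprS powRM ?exprn_ge0// => ye.
have := lerD (lerD (point_mean x n) means) ye.
set mx := mean _ _ _; set my := mean _ _ _ => le.
have -> : u x - u y = (u x - mx) + (mx - my) + (my - u y) by ring.
apply: le_trans (ler_normD _ _) _.
apply: le_trans (lerD (ler_normD _ _) (lexx _)) _.
by apply: le_trans le _; rewrite le_eqVlt; apply/orP; left; apply/eqP;
  rewrite /K_two; ring.
Qed.

Lemma morrey x y : x != y ->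
  `|u x - u y| `^ p <=
  (K_two * 2 `^ a) `^ p * e `^ p * (gdist G x y)%:R `^ (p - D).
Proof.
move=> xy; set d := gdist G x y.
have d_gt0 : (0 < d)%N.
  by rewrite lt0n; apply: contra xy => /eqP /(gdist_eq0 conn) ->.
(* [2^(n + 1)] is the dyadic radius with [d < 2^(n + 1) <= 2 * d]. *)
have /andP[n_le n_gt] := trunc_log_bounds (isT : (1 < 2)%N) d_gt0.
set n := trunc_log 2 d in n_le n_gt.
have dn : d%:R <= 2 ^+ n.+1 :> R by rewrite -natrX ler_nat ltnW.
have K2_ge0 : 0 <= K_two * 2 `^ a.
  exact: mulr_ge0 (ltW K_two_gt0) (powR_ge0 _ _).
have le : `|u x - u y| <= K_two * 2 `^ a * e * d%:R `^ a.
  have -> : K_two * 2 `^ a * e * d%:R `^ a = K_two * e * (2 * d%:R) `^ a.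
    by rewrite powRM//; ring.
  apply: le_trans (two_points_dyadic dn) _.
  apply: ler_wpM2l; first exact: mulr_ge0 (ltW K_two_gt0) (ltW e_gt0).
  rewrite ge0_ler_powR ?nnegrE ?(ltW a_gt0) ?exprn_ge0 ?mulr_ge0//.
  by rewrite exprS ler_wpM2l// -natrX ler_nat.
have := ge0_ler_powR (ltW p_gt0) _ _ le.
rewrite !nnegrE => /(_ _ _)/le_trans; apply.
- by [].
- exact: mulr_ge0 (mulr_ge0 K2_ge0 (ltW e_gt0)) (powR_ge0 _ _).
rewrite (powRM _ (mulr_ge0 K2_ge0 (ltW e_gt0)) (powR_ge0 _ _)).
rewrite (powRM _ K2_ge0 (ltW e_gt0)).
rewrite -powRrM (_ : a * p = p - D) ?lexx//.
by rewrite /a mulrBl mul1r divfK// gt_eqF.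
Qed.

End Graph.

Lemma morrey_inequality : exists2 K : R, 0 < K &
  forall (V : choiceType) (G : weighted_graph R V),
    connected_graph G -> locally_finite G ->
    condG1 G C0 -> condG2 G D C1 -> condG3 G C2 ->
    forall (u : V -> R) (F : R), 0 < F ->
    (forall B : {fset V},
      \sum_(x <- B) \sum_(y <- B) omega G x y * `|u x - u y| `^ p <= F) ->
    forall x y, x != y ->
      `|u x - u y| `^ p <= K * F * (gdist G x y)%:R `^ (p - D).
Proof.
exists ((K_two * 2 `^ a) `^ p).
  by rewrite powR_gt0// mulr_gt0// powR_gt0.
move=> V G conn lf g1 g2 g3 u F F_gt0 energy_le x y xy.
have FE : F = (F `^ p^-1) `^ p.
  by rewrite -powRrM mulVf ?gt_eqF// powRr1// ltW.
rewrite FE; apply: morrey => // [|B]; first exact: powR_gt0.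
by rewrite -FE; exact: energy_le.
Qed.

End Morrey.

(** * From points to the eigenvalue *)

(** Distances are natural numbers, so a nearest point of the complement exists;
    the complement is nonempty because [V] is infinite. *)
Lemma inner_radius_attained (R : realType) (V : choiceType)
    (G : weighted_graph R V) (Omega : {fset V}) (x : V) : x \in Omega ->
  exists2 y, y \notin Omega & (gdist G x y)%:R <= inner_radius G Omega.
Proof.
move=> xO; pose dist z : R := inf [set ((gdist G z y)%:R : R) |
  y in [set y | y \notin Omega]].
have [y0 y0O] : exists y, y \notin Omega.
  apply: contrapT => allO; apply: infinite_nat.
  rewrite -(eq_finite_set (vertices_countably_infinite G)).
  apply: (sub_finite_set (B := [set` Omega])) => // y _ /=.
  by apply: contrapT => /negP yO; apply: allO; exists y.
have ex : exists n, `[< exists2 y, y \notin Omega & gdist G x y = n >].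
  by exists (gdist G x y0); apply/asboolP; exists y0.
have [_ /asboolP[y yO <-] ymin] := ex_minnP ex.
exists y => //; apply: (@le_trans _ _ (dist x)).
  apply: lb_le_inf; first by exists (gdist G x y0)%:R, y0.
  move=> _ [z zO <-]; rewrite ler_nat; apply: ymin.
  by apply/asboolP; exists z.
apply: ub_le_sup; last by exists x.
(* Any upper bound of the distances over the finite set [Omega] will do. *)
exists (\sum_(z <- Omega) `|dist z|) => _ [z zO <-].
rewrite (big_fsetD1 z)//=; apply: le_trans (ler_norm _) _.
by rewrite lerDl sumr_ge0.
Qed.

Lemma esum_energy_ge (R : realType) (V : choiceType) (G : weighted_graph R V)
    (p : R) (u : V -> R) (B : {fset V}) :
  ((\sum_(x <- B) \sum_(y <- B) omega G x y * `|u x - u y| `^ p)%:E <=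
   \esum_(z in [set: V * V]) (omega G z.1 z.2 * `|u z.2 - u z.1| `^ p)%:E)%E.
Proof.
apply: esum_ge; exists ([set` B] `*` [set` B]).
  by split => //; exact: finite_setX.
rewrite -(pair_fsbig _ (fun x y => (omega G x y * `|u y - u x| `^ p)%:E))//.
rewrite fsbig_finite// set_fsetK -sumEFin; apply: lee_sum => x _.
rewrite fsbig_finite// set_fsetK -sumEFin; apply: lee_sum => y _.
by rewrite distrC.
Qed.

Theorem corollary4p2 (R : realType) (D C0 C1 C2 p : R)
    (hD : 1 < D) (hC0 : 1 <= C0) (hC1 : 1 <= C1) (hC2 : 1 <= C2) (hp : D < p) :
  exists c : R, 0 < c /\
    forall (V : choiceType) (G : weighted_graph R V),
      connected_graph G -> locally_finite G ->
      condG1 G C0 -> condG2 G D C1 -> condG3 G C2 ->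
      forall (Omega : {fset V}) (w : Omega -> R),
        (exists x : V, x \in Omega) ->
        (forall x, 0 <= w x) -> (exists x, w x != 0) ->
        ((c / (inner_radius G Omega `^ (p - D) * l1norm G w))%:E
           <= lambda1 G p w)%E.
Proof.
have [K K_gt0 morrey] := morrey_inequality hD hC0 hC1 hC2 hp.
exists (4 * K)^-1; split; first by rewrite invr_gt0 mulr_gt0.
move=> V G conn lf g1 g2 g3 Omega w [x0 x0O] w_ge0 [x1 wx1].
have r_gt0 : 0 < inner_radius G Omega.
  have [y yO] := inner_radius_attained G x0O; apply: lt_le_trans.
  rewrite ltr0n lt0n; apply: contra yO => /eqP /(gdist_eq0 conn) <-; exact: x0O.
have L_gt0 : 0 < l1norm G w.
  rewrite /l1norm (bigD1 x1)//= ltr_pwDl ?mulr_gt0 ?normr_gt0 ?mu_gt0//.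
  by apply: sumr_ge0 => x _; rewrite mulr_ge0// ltW// mu_gt0.
set r := inner_radius G Omega in r_gt0 *; set L := l1norm G w in L_gt0 *.
have rp_gt0 : 0 < r `^ (p - D) by exact: powR_gt0.
apply: le_ereal_inf_tmp => _ [u [u0 /= N_gt0] <-].
set N := weighted_pnorm G p w u in N_gt0 *.
rewrite lee_pdivlMr// leNgt; apply/negP.
set q := (_ / _) => small.
(* If the quotient were below [q], twice the energy would be below [F], and
   the Morrey inequality would give [N <= N / 2]: whence the factor [4], a [2]
   for the two orientations of an edge and a [2] for strictness. *)
pose F := 2 * (q * N).
have q_gt0 : 0 < q by rewrite divr_gt0 ?mulr_gt0// invr_gt0 mulr_gt0.
have F_gt0 : 0 < F by exact: mulr_gt0 (ltr0Sn _ _) (mulr_gt0 q_gt0 N_gt0).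
move: small; rewrite /energy lte_pdivrMl// -!EFinM => small.
have energy_le (B : {fset V}) : \sum_(x <- B) \sum_(y <- B)
    omega G x y * `|u x - u y| `^ p <= F.
  by rewrite -lee_fin; apply: le_trans (esum_energy_ge G p u B) (ltW small).
have u_le (x : Omega) : `|u (val x)| `^ p <= K * F * r `^ (p - D).
  have [y yO dy] := inner_radius_attained G (valP x).
  have xy : val x != y by apply: contraNneq yO => <-; exact: valP.
  have := morrey V G conn lf g1 g2 g3 u F F_gt0 energy_le _ _ xy.
  rewrite (u0 y yO) subr0 => /le_trans; apply.
  rewrite ler_wpM2l ?ge0_ler_powR ?nnegrE ?subr_ge0 ?ler0n ?(ltW hp)//
    ?(ltW r_gt0)//.
  by rewrite mulr_ge0// ltW.
have : N <= K * F * r `^ (p - D) * L.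
  rewrite /N /L /weighted_pnorm /l1norm mulr_sumr; apply: ler_sum => x _.
  by rewrite (ger0_norm (w_ge0 x)) mulrC ler_wpM2r// mulr_ge0// ltW// mu_gt0.
have -> : K * F * r `^ (p - D) * L = N / 2.
  by rewrite /F /q; field; rewrite !gt_eqF.
by rewrite leNgt ltr_pdivrMr// ltr_pMr// ltr1n.
Qed.
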